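(* Let $F$ be the autonomous Riccati hierarchy (with $c=1$) on $\mathbb{C}^m$. On the open set $\{x_m\neq0\}$, define $$y_i:=\frac{x_i}{x_m}\quad(i=1,\dots,m-1),\qquad u:=\frac1{x_m}.$$ Then the $z_1$-flow $\partial_{z_1}x=F(x)$ is transformed into the triangular system $$\partial_{z_1}y_i=y_{i+1}\quad(1\le i\le m-2),\qquad \partial_{z_1}y_{m-1}=1,\qquad \partial_{z_1}u=y_1 .$$ Consequently, $$u(z_1,z_2)=\frac{z_1^m}{m!}+a_{m-1}(z_2)\frac{z_1^{m-1}}{(m-1)!}+\cdots+a_1(z_2)z_1+a_0(z_2),$$ where $a_0,\dots,a_{m-1}$ depend only on $z_2$, and $$y_i(z_1,z_2)=\partial_{z_1}^iu(z_1,z_2)\qquad(i=1,\dots,m-1).$$ Hence the general solution of the autonomous Riccati hierarchy (for the $z_1$-flow, with $z_2$ as a parameter) is $$x_m(z_1,z_2)=\frac1{u(z_1,z_2)},\qquad x_i(z_1,z_2)=\frac{y_i(z_1,z_2)}{u(z_1,z_2)}=\frac{\partial_{z_1}^iu(z_1,z_2)}{u(z_1,z_2)}\quad(i=1,\dots,m-1).$$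
   Context: Here $m\in\mathbb{N}$. The autonomous Riccati hierarchy (with $c=1$) is the vector field $F=(f_1,\dots,f_m)$ on $\mathbb{C}^m$ given by $$f_i(x)=x_{i+1}-x_1x_i\quad(1\le i\le m-1),\qquad f_m(x)=-x_1x_m .$$ Its flow variable is denoted $z_1$, so the $z_1$-flow is $\partial x_i/\partial z_1=f_i(x)$, $i=1,\dots,m$. The variable $z_2$ is the flow variable of a second vector field $G=(g_1,\dots,g_m)$ commuting with $F$, namely $g_i=x_ix_m$ for $1\le i\le m-1$ and $g_m=x_m^2$; in this statement $z_2$ is held fixed and enters only as a parameter. *)

(* Defs.v *)
From HB Require Import structures.
From mathcomp Require Import all_boot all_order all_algebra.
From mathcomp Require Import all_classical all_reals topology normedtype derive.
From mathcomp Require Import complex.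
Set Implicit Arguments.
Unset Strict Implicit.
Unset Printing Implicit Defensive.
Import Order.TTheory GRing.Theory Num.Theory.
Import numFieldNormedType.Exports.
Local Open Scope classical_set_scope.
Local Open Scope ring_scope.
Local Open Scope complex_scope.

(* The complex field as a normed space over itself (topology of the modulus),
   so that [is_derive z 1 f l] on functions R[i] -> R[i] is complex
   differentiability at z with derivative l. *)
#[non_forgetful_inheritance]
HB.instance Definition _ (R : realType) := NormedModule.copy R[i] R[i]^o.

(* Throughout, the dimension is m = n.+1, so that m >= 1. *)

(* The i-th coordinate with the 1-based numbering x_1, ..., x_m. Only meaningful
   for 1 <= i <= m: inord sends out-of-range arguments to 0. *)
Definition xcoord (R : realType) (n : nat) (x : 'rV[R[i]]_n.+1) (i : nat) : R[i] :=
  x 0 (inord i.-1).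

(* The column j : 'I_m carries the component f_i with i = j.+1. *)
Definition riccati_field (R : realType) (n : nat) (x : 'rV[R[i]]_n.+1) :
    'rV[R[i]]_n.+1 :=
  \row_(j < n.+1)
    if (j.+1 < n.+1)%N then xcoord x j.+2 - xcoord x 1 * xcoord x j.+1
    else - xcoord x 1 * xcoord x n.+1.

Definition z1_flow_on (R : realType) (n : nat) (D : set (R[i] * R[i]))
    (x : R[i] -> R[i] -> 'rV[R[i]]_n.+1) : Prop :=
  forall z1 z2 : R[i], D (z1, z2) -> forall j : 'I_n.+1,
    is_derive z1 1 (fun w : R[i] => x w z2 0 j) (riccati_field (x z1 z2) 0 j).

(* Domain of the variables (z1, z2): z2 is only a parameter, so the conditions
   bear on the slices in z1. *)
Definition open_slices (R : realType) (D : set (R[i] * R[i])) : Prop :=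
  forall z2 : R[i], open [set z1 : R[i] | D (z1, z2)].

Definition connected_slices (R : realType) (D : set (R[i] * R[i])) : Prop :=
  forall z2 : R[i], connected [set z1 : R[i] | D (z1, z2)].

Definition xm_neq0_on (R : realType) (n : nat) (D : set (R[i] * R[i]))
    (x : R[i] -> R[i] -> 'rV[R[i]]_n.+1) : Prop :=
  forall z1 z2 : R[i], D (z1, z2) -> xcoord (x z1 z2) n.+1 != 0.

Definition ycoord (R : realType) (n : nat) (x : R[i] -> R[i] -> 'rV[R[i]]_n.+1)
    (i : nat) (z1 z2 : R[i]) : R[i] :=
  xcoord (x z1 z2) i / xcoord (x z1 z2) n.+1.

Definition ucoord (R : realType) (n : nat) (x : R[i] -> R[i] -> 'rV[R[i]]_n.+1)
    (z1 z2 : R[i]) : R[i] :=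
  1 / xcoord (x z1 z2) n.+1.

(* The triangular system for y_1, ..., y_{m-1}, u (other values of y are
   unused). When m = 1 there is no y_i and the system reduces to u' = 1, in
   accordance with the convention y_m = x_m / x_m = 1. *)
Definition triangular_on (R : realType) (m : nat) (D : set (R[i] * R[i]))
    (y : nat -> R[i] -> R[i] -> R[i]) (u : R[i] -> R[i] -> R[i]) : Prop :=
  forall z1 z2 : R[i], D (z1, z2) ->
    [/\ forall i : nat, (1 <= i)%N -> (i.+2 <= m)%N ->
          is_derive z1 1 (fun w : R[i] => y i w z2) (y i.+1 z1 z2),
        (2 <= m)%N -> is_derive z1 1 (fun w : R[i] => y m.-1 w z2) 1
      & is_derive z1 1 (fun w : R[i] => u w z2)
          (if m == 1%N then 1 else y 1%N z1 z2)].

Definition upoly (R : realType) (m : nat) (a : 'I_m -> R[i] -> R[i])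
    (z1 z2 : R[i]) : R[i] :=
  z1 ^+ m / (m`!)%:R + \sum_(k < m) a k z2 * (z1 ^+ k / (k`!)%:R).

Definition dz1 (R : realType) (i : nat) (u : R[i] -> R[i] -> R[i])
    (z1 z2 : R[i]) : R[i] :=
  derive1n i (fun w : R[i] => u w z2) z1.

Definition general_solution (R : realType) (n : nat)
    (a : 'I_n.+1 -> R[i] -> R[i]) (z1 z2 : R[i]) : 'rV[R[i]]_n.+1 :=
  \row_(j < n.+1)
    if (j.+1 < n.+1)%N then dz1 j.+1 (upoly a) z1 z2 / upoly a z1 z2
    else 1 / upoly a z1 z2.

(* Main.v *)
Require Import Defs.
From HB Require Import structures.
From mathcomp Require Import all_boot all_order all_algebra.
From mathcomp Require Import all_classical all_reals topology normedtype derive.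
From mathcomp Require Import complex.
From mathcomp Require Import ring.
Set Implicit Arguments.
Unset Strict Implicit.
Unset Printing Implicit Defensive.
Import Order.TTheory GRing.Theory Num.Theory.
Import numFieldNormedType.Exports.
Local Open Scope classical_set_scope.
Local Open Scope ring_scope.
Local Open Scope complex_scope.

(** The Riccati hierarchy is a linear flow seen in an affine chart.  Put
   h_0 = 1, h_i = x_i for 1 <= i <= m and h_i = 0 for i > m.  The z1-flow says
   exactly h_i' = h_(i+1) - h_1 h_i for every i, so that the term - h_1 h_i,
   common to all the coordinates, disappears from the derivative of a quotient:
   Y_i = h_i / h_m satisfies Y_i' = Y_(i+1).  Here Y_0 = u, Y_i = y_i for
   1 <= i <= m-1, Y_m = 1 and Y_i = 0 for i > m, hence this chain of equations
   is the triangular system.  In the other direction x_i = Y_i / Y_0, and the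
   quotient rule applied to any chain with Y_0 != 0 gives the Riccati equations
   back ([chain_ratio]).

   The chain Y' = shift Y is nilpotent, so on a connected open set its solutions
   are the polynomials Y_k = sum_j c_(k+j) z^j / j! ([nilpotent_chain_taylor]):
   starting from the vanishing terms, each Y_k is determined up to a constant by
   Y_(k+1).  The condition Y_m = 1 means c_m = 1, and Y_0 is the announced
   polynomial u with a_k = c_k.  Since every term of a chain is the derivative of
   the previous one, Y_i is the i-th derivative of u, which gives the formulas
   for the y_i and for x.  Conversely the polynomials above always form a chain,
   so their quotients Y_i / Y_0 solve the hierarchy wherever u != 0.

   The analytic input is that a function on a connected open subset of the
   complex plane whose complex derivative vanishes is constant
   ([derive0_connected_constant]).  It reduces to the real mean value theorem
   along segments, applied to the real part of f and of -i f. *)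

(** * Functions with vanishing complex derivative *)

Lemma normc_real (R : realType) (h : R) : `|h%:C| = `|h|%:C.
Proof. by rewrite normc_def /= expr0n /= addr0 sqrtr_sqr. Qed.

Lemma Re_realM (R : realType) (a : R) (z : R[i]) :
  complex.Re (a%:C * z) = a * complex.Re z.
Proof. by case: z => x y /=; rewrite mul0r subr0. Qed.

(** Transfers a vanishing complex derivative to a real variable: a real increment
   h along the segment is the complex increment h d, so the real difference
   quotient is at most |d| times the modulus of the complex one. *)
Lemma Re_comp_segment_derive0 (R : realType) (f : R[i] -> R[i]) (z d : R[i])
    (t : R) :
  is_derive (z + t%:C * d) 1 f 0 ->
  is_derive t 1 (fun s : R => complex.Re (f (z + s%:C * d))) 0.
Proof.
move=> [df f0].
have [->|d0] := eqVneq d 0.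
  rewrite (_ : (fun s => _) = cst (complex.Re (f z))).
    exact: is_derive_cst.
  by apply/funext => s; rewrite mulr0 addr0.
pose g (s : R) := complex.Re (f (z + s%:C * d)).
suff dg0 : (fun h : R => h^-1 *: ((g \o shift t) (h *: 1) - g t)) @ 0^' -->
    (0 : R).
  by apply: DeriveDef; [apply/cvg_ex; exists 0 | exact: cvg_lim dg0].
move/cvg_ex : (df) => [l fl].
have l0 : l = 0 by rewrite -f0; apply/esym/cvg_lim.
rewrite {}l0 in fl.
apply/cvgrPdist_lt => e e0.
have dp : 0 < `|d| by rewrite normr_gt0.
(* The increment h d turns the bound e / |d| into e. *)
have ec : 0 < e%:C / `|d| by rewrite divr_gt0// ltcR.
move/cvgrPdist_lt : fl => /(_ _ ec) [r /= r0 fr].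
have rd : 0 < r / `|d| by rewrite divr_gt0.
(* A positive complex number is real; the radius in R is its real part. *)
have rdE : r / `|d| = (complex.Re (r / `|d|))%:C.
  by move: rd; case: (r / `|d|) => a b /=; rewrite ltcE /= => /andP[/eqP -> _].
exists (complex.Re (r / `|d|)) => /=; first by rewrite -ltcR -rdE.
move=> h; rewrite /= sub0r normrN => hr h0.
have hC0 : h%:C != 0 by rewrite -(inj_eq (@complexI R)) in h0.
have := fr (h%:C * d); rewrite /= !sub0r !normrN.
rewrite normrM -ltr_pdivlMr// normc_real rdE ltcR => /(_ hr).
rewrite mulf_neq0// => /(_ isT).
rewrite ltr_pdivlMr// -normrM -ltcR; apply: le_lt_trans.
rewrite /GRing.scale /= mulr1.
have -> : complex.Re (f (z + (h + t)%:C * d)) - complex.Re (f (z + t%:C * d)) =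
   complex.Re (f (h%:C * d * 1 + (z + t%:C * d)) - f (z + t%:C * d)).
  rewrite (_ : z + (h + t)%:C * d = h%:C * d * 1 + (z + t%:C * d)).
    by rewrite raddfB.
  by rewrite rmorphD /=; ring.
rewrite -Re_realM (le_trans (normc_ge_Re _))// le_eqVlt; apply/orP; left; apply/eqP.
congr `| _ |; rewrite fmorphV /=; set F := (f _ - f _).
field.
by rewrite d0.
Qed.

Lemma Re_locally_constant (R : realType) (A : set R[i]) (f : R[i] -> R[i]) :
  open A -> (forall z, A z -> is_derive z 1 f 0) ->
  forall z, A z -> \forall w \near z, complex.Re (f w) = complex.Re (f z).
Proof.
move=> Aopen df z Az.
have /nbhs_ballP[r /= r0 rA] : nbhs z A by exact: open_nbhs_nbhs.
apply/nbhs_ballP; exists r => //= w zw.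
have seg (t : R) : t \in `[0, 1] ->
    is_derive t 1 (fun s : R => complex.Re (f (z + s%:C * (w - z)))) 0.
  rewrite in_itv /= => /andP[t0 t1].
  apply: Re_comp_segment_derive0; apply: df; apply: rA.
  move: zw; rewrite -!ball_normE /= opprD addrA subrr sub0r normrN.
  apply: le_lt_trans.
  rewrite normrM normc_real (ger0_norm t0) distrC.
  have tC1 : t%:C <= 1 by rewrite -(rmorph1 (real_complex R)) lecR.
  by apply: ler_piMl.
set g := (fun s : R => complex.Re (f (z + s%:C * (w - z)))) in seg.
have dg (t : R) : t \in `]0, 1[ -> is_derive t 1 g ((fun=> 0) t).
  by move=> /subset_itv_oo_cc; exact: seg.
have cg : {within `[0, 1], continuous g}.
  by apply: derivable_within_continuous => t /seg[].
have [c _] := MVT_segment (ler01 : (0 : R) <= 1) dg cg.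
rewrite mul0r => /subr0_eq; rewrite /g rmorph1 rmorph0.
by rewrite mul1r mul0r addr0 subrKC.
Qed.

(** The imaginary part of f is the real part of -i f. *)
Lemma derive0_locally_constant (R : realType) (A : set R[i]) (f : R[i] -> R[i]) :
  open A -> (forall z, A z -> is_derive z 1 f 0) ->
  forall z, A z -> \forall w \near z, f w = f z.
Proof.
move=> Aopen df z Az.
have dif : forall z, A z -> is_derive z 1 (fun w => - 'i * f w) 0.
  move=> w /df dfw; have := @is_deriveZ _ _ _ f (- 'i) w 1 0 dfw.
  by rewrite scaler0.
have Re_near := Re_locally_constant Aopen df Az.
have Im_near := Re_locally_constant Aopen dif Az.
near=> w.
have : complex.Re (- 'i * f w) = complex.Re (- 'i * f z) by near: w.
have : complex.Re (f w) = complex.Re (f z) by near: w.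
case: (f w) (f z) => [a b] [c d] /= ->.
by rewrite !oppr0 !mul0r !sub0r !mulN1r !opprK => ->.
Unshelve. all: by end_near. Qed.

(** Every level set of f in A, and every union of level sets, is open because f is
   locally constant; so a nonempty level set is open and closed in A. *)
Lemma derive0_connected_constant (R : realType) (A : set R[i]) (f : R[i] -> R[i]) :
  open A -> connected A -> (forall z, A z -> is_derive z 1 f 0) ->
  exists c, forall z, A z -> f z = c.
Proof.
move=> Aopen Aconn df.
have [[z0 Az0]|A0] := pselect (A !=set0); last first.
  by exists 0 => z Az; case: A0; exists z.
exists (f z0) => z Az.
have loc := derive0_locally_constant Aopen df.
have lvl_open (P : set R[i]) : open (A `&` f @^-1` P).
  rewrite openE => w [Aw Pw]; apply: filterI; first exact: open_nbhs_nbhs.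
  by apply: filterS (loc _ Aw) => v /= ->.
suff AE : A `&` f @^-1` [set f z0] = A.
  by move: Az; rewrite -[X in X z]AE => -[].
apply: Aconn; first by exists z0.
- by exists (A `&` f @^-1` [set f z0]) => //; rewrite setIA setIid.
- exists (~` (A `&` f @^-1` (~` [set f z0]))); first exact: open_closedC.
  by rewrite setCI setIUr setICr set0U preimage_setC setCK.
Qed.

(** * Chains of successive derivatives *)

Lemma is_derive_div (K : numFieldType) (z : K) (f g : K -> K) (f' g' : K) :
  g z != 0 -> is_derive z 1 f f' -> is_derive z 1 g g' ->
  is_derive z 1 (fun w => f w / g w) (f' / g z - f z / g z * (g' / g z)).
Proof.
move=> g0 df dg.
have di : is_derive z 1 (fun w => (g w)^-1) (- g z ^- 2 *: g').
  by apply: DeriveDef; [exact: derivableV | rewrite deriveV// derive_val].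
apply: is_derive_eq; rewrite /GRing.scale /=; field.
exact: g0.
Qed.

Definition derivative_chain (K : numFieldType) (A : set K) (Y : nat -> K -> K) :=
  forall k z, A z -> is_derive z 1 (Y k) (Y k.+1 z).

(** Openness of A is what allows the induction: the k-th derivative has to agree with
   Y k near z, not only at z, for their derivatives to agree. *)
Lemma derivative_chain_derive1n (K : numFieldType) (A : set K)
    (Y : nat -> K -> K) :
  open A -> derivative_chain A Y ->
  forall k z, A z -> derive1n k (Y 0%N) z = Y k z.
Proof.
move=> Aopen dY; elim=> [//|k IH] z Az.
rewrite derive1nS derive1E.
have [_ <-] := dY k z Az.
apply: near_eq_derive; apply: filterS (IH) _.
exact: open_nbhs_nbhs.
Qed.

Lemma is_derive_horner (K : numFieldType) (p : {poly K}) (z : K) :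
  is_derive z 1 (horner p) p^`().[z].
Proof.
elim/poly_ind: p => [|p c IH].
  rewrite deriv0 horner0 (_ : horner 0 = cst 0); first exact: is_derive_cst.
  by apply/funext => w; rewrite horner0.
rewrite (_ : horner _ = horner p * id + cst c).
  apply: is_derive_eq; rewrite derivD derivC addr0 derivM derivX mulr1.
  by rewrite !hornerE /GRing.scale /=; ring.
by apply/funext => w; rewrite !hornerE.
Qed.

(** The k-th derivative of the polynomial whose Taylor coefficients at 0 are the
   c i, written with the shifted sequence. When c vanishes from N on, the
   truncation at N loses nothing, whatever k is. *)
Definition taylor_poly (K : numFieldType) (N : nat) (c : nat -> K) (k : nat) :
    {poly K} :=
  \poly_(j < N) (c (k + j)%N / (j`!)%:R).

Lemma deriv_taylor_poly (K : numFieldType) (N : nat) (c : nat -> K) (k : nat) :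
  (forall i, (N <= i)%N -> c i = 0) ->
  (taylor_poly N c k)^`() = taylor_poly N c k.+1.
Proof.
move=> c0; apply/polyP => i; rewrite coef_deriv !coef_poly addSnnS.
have [ltiN|leNi] := ltnP i.+1 N.
  rewrite (ltnW ltiN) factS natrM invfM -[LHS]mulr_natr.
  by rewrite mulrC mulrCA mulVKf// pnatr_eq0.
rewrite mul0rn; case: ifP => // _.
by rewrite c0 ?mul0r// (leq_trans leNi)// leq_addl.
Qed.

Lemma taylor_poly_chain (K : numFieldType) (N : nat) (c : nat -> K) (A : set K) :
  (forall i, (N <= i)%N -> c i = 0) ->
  derivative_chain A (fun k z => (taylor_poly N c k).[z]).
Proof.
by move=> c0 k z _; rewrite -(deriv_taylor_poly k c0); exact: is_derive_horner.
Qed.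

Lemma taylor_poly_top (K : numFieldType) (N : nat) (c : nat -> K) (z : K) :
  (forall i, (N.+1 <= i)%N -> c i = 0) -> (taylor_poly N.+1 c N).[z] = c N.
Proof.
move=> c0; rewrite horner_poly big_ord_recl big1 ?addr0 => [|j _].
  by rewrite addn0 expr0 mulr1 divr1.
by rewrite c0 ?mul0r// lift0 addnS ltnS leq_addr.
Qed.

(** By induction on N, the shifted chain Y_1, Y_2, ... being shorter by one. Its
   coefficients c give those of Y up to the constant term, and Y_0 differs by a
   constant from the polynomial with constant term 0. *)
Lemma nilpotent_chain_taylor (R : realType) (A : set R[i])
    (Y : nat -> R[i] -> R[i]) (N : nat) :
  open A -> connected A -> derivative_chain A Y ->
  (forall k z, (N <= k)%N -> A z -> Y k z = 0) ->
  exists2 c : nat -> R[i], forall i, (N <= i)%N -> c i = 0 &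
    forall k z, A z -> Y k z = (taylor_poly N c k).[z].
Proof.
move=> Aopen Aconn; elim: N Y => [|N IH] Y dY Y0.
  exists (fun=> 0) => // k z Az.
  by rewrite Y0// horner_poly big_ord0.
have [|k z Nk Az|c c0 Yc] := IH (fun k => Y k.+1).
- by move=> k; exact: dY.
- exact: Y0.
pose ext e k := if k is k'.+1 then c k' else e : R[i].
have ext0 e i : (N.+1 <= i)%N -> ext e i = 0.
  by case: i => // i; rewrite ltnS => /c0.
have extS e k z : A z -> Y k.+1 z = (taylor_poly N.+1 (ext e) k.+1).[z].
  move=> Az; rewrite Yc// !horner_poly big_ord_recr /= c0 ?leq_addl//.
  by rewrite !mul0r addr0.
have [e Ye] : exists e, forall z, A z ->
    Y 0%N z - (taylor_poly N.+1 (ext 0) 0).[z] = e.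
  apply: (derive0_connected_constant Aopen Aconn) => z Az.
  have := is_deriveB (dY 0%N z Az) (taylor_poly_chain (ext0 0) 0 Az).
  by rewrite -extS// subrr.
exists (ext e) => [|[|k] z Az]; [exact: ext0 | | exact: extS].
rewrite -[LHS](subrK (taylor_poly N.+1 (ext 0) 0).[z]) Ye//.
by rewrite !horner_poly !big_ord_recl /= fact0 !expr0 !mulr1 invr1 !mulr1 add0r.
Qed.

(** * Linearization in homogeneous coordinates *)

(** Homogeneous coordinates (1 : x_1 : ... : x_m), continued by 0 so that the
   Riccati equations take the same form for all the indices. *)
Definition hcoord (R : realType) (n : nat) (x : 'rV[R[i]]_n.+1) (i : nat) :
    R[i] :=
  if i == 0%N then 1 else if (i <= n.+1)%N then xcoord x i else 0.

Lemma hcoordS (R : realType) (n : nat) (x : 'rV[R[i]]_n.+1) (j : 'I_n.+1) :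
  hcoord x j.+1 = x 0 j.
Proof. by rewrite /hcoord /= ltn_ord /xcoord /= inord_val. Qed.

Lemma hcoord_last (R : realType) (n : nat) (x : 'rV[R[i]]_n.+1) :
  hcoord x n.+1 = xcoord x n.+1.
Proof. by rewrite /hcoord /= leqnn. Qed.

Lemma hcoord_gt (R : realType) (n : nat) (x : 'rV[R[i]]_n.+1) (i : nat) :
  (n.+1 < i)%N -> hcoord x i = 0.
Proof. by case: i => // i ni; rewrite /hcoord /= leqNgt ni. Qed.

Lemma riccati_field_hcoord (R : realType) (n : nat) (x : 'rV[R[i]]_n.+1)
    (j : 'I_n.+1) :
  riccati_field x 0 j = hcoord x j.+2 - hcoord x 1 * hcoord x j.+1.
Proof.
rewrite mxE /hcoord /= ltn_ord.
have [//|nj] := ltnP j.+1 n.+1.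
suff -> : j.+1 = n.+1 by rewrite sub0r mulNr.
by apply/eqP; rewrite eqn_leq nj ltn_ord.
Qed.

(** The equations added by h_0 = 1 and by h_i = 0 for i > m are trivially true; for
   i = m the missing term x_(m+1) of the hierarchy is h_(m+1) = 0. *)
Lemma z1_flow_hcoord (R : realType) (n : nat) (D : set (R[i] * R[i]))
    (x : R[i] -> R[i] -> 'rV[R[i]]_n.+1) :
  z1_flow_on D x -> forall z1 z2, D (z1, z2) -> forall i,
    is_derive z1 1 (fun w => hcoord (x w z2) i)
      (hcoord (x z1 z2) i.+1 - hcoord (x z1 z2) 1 * hcoord (x z1 z2) i).
Proof.
move=> xflow z1 z2 Dz [|i].
  by rewrite [X in _ * X]/hcoord mulr1 subrr; exact: is_derive_cst.
have [lti|gti] := ltnP i n.+1.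
  have := xflow _ _ Dz (Ordinal lti); rewrite riccati_field_hcoord.
  by under eq_fun do rewrite -hcoordS.
have -> : hcoord (x z1 z2) i.+2 = 0 by rewrite hcoord_gt// ltnS leqW.
have hi0 w : hcoord (x w z2) i.+1 = 0 by rewrite hcoord_gt.
rewrite hi0 mulr0 subr0; under eq_fun do rewrite hi0.
exact: is_derive_cst.
Qed.

(** The homogeneous coordinates normalized by x_m = 1: this is u for i = 0, y_i for
   1 <= i <= m-1, and 1 for i = m. *)
Definition lin_coord (R : realType) (n : nat)
    (x : R[i] -> R[i] -> 'rV[R[i]]_n.+1) (z2 : R[i]) (i : nat) (z1 : R[i]) :
    R[i] :=
  hcoord (x z1 z2) i / hcoord (x z1 z2) n.+1.

Lemma ucoordE (R : realType) (n : nat) (x : R[i] -> R[i] -> 'rV[R[i]]_n.+1)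
    (z1 z2 : R[i]) :
  ucoord x z1 z2 = lin_coord x z2 0 z1.
Proof. by rewrite /lin_coord hcoord_last. Qed.

Lemma ucoord_fun (R : realType) (n : nat) (x : R[i] -> R[i] -> 'rV[R[i]]_n.+1)
    (z2 : R[i]) :
  (ucoord x)^~ z2 = lin_coord x z2 0.
Proof. by apply/funext => z1; exact: ucoordE. Qed.

Lemma ycoordE (R : realType) (n : nat) (x : R[i] -> R[i] -> 'rV[R[i]]_n.+1)
    (i : nat) (z1 z2 : R[i]) :
  (0 < i <= n.+1)%N -> ycoord x i z1 z2 = lin_coord x z2 i z1.
Proof.
by case: i => // i lei; rewrite /lin_coord hcoord_last /hcoord /= ifT.
Qed.

Lemma ycoord_fun (R : realType) (n : nat) (x : R[i] -> R[i] -> 'rV[R[i]]_n.+1)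
    (i : nat) (z2 : R[i]) :
  (0 < i <= n.+1)%N -> (ycoord x i)^~ z2 = lin_coord x z2 i.
Proof. by move=> lei; apply/funext => z1; exact: ycoordE. Qed.

Lemma lin_coord_gt (R : realType) (n : nat)
    (x : R[i] -> R[i] -> 'rV[R[i]]_n.+1) (i : nat) (z2 z1 : R[i]) :
  (n.+1 < i)%N -> lin_coord x z2 i z1 = 0.
Proof. by move=> ni; rewrite /lin_coord hcoord_gt// mul0r. Qed.

Lemma lin_coord_last (R : realType) (n : nat) (D : set (R[i] * R[i]))
    (x : R[i] -> R[i] -> 'rV[R[i]]_n.+1) (z1 z2 : R[i]) :
  xm_neq0_on D x -> D (z1, z2) -> lin_coord x z2 n.+1 z1 = 1.
Proof. by move=> xm0 Dz; rewrite /lin_coord divff// hcoord_last xm0. Qed.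

(** For m = 1 there is no y_1, and its place in u' = y_1 is taken by
   x_m / x_m = 1. *)
Lemma lin_coord1 (R : realType) (n : nat) (D : set (R[i] * R[i]))
    (x : R[i] -> R[i] -> 'rV[R[i]]_n.+1) (z1 z2 : R[i]) :
  xm_neq0_on D x -> D (z1, z2) ->
  (if n.+1 == 1%N then 1 else ycoord x 1 z1 z2) = lin_coord x z2 1 z1.
Proof.
move=> xm0 Dz; case: eqP => [n0|_]; last by rewrite ycoordE.
by rewrite -(lin_coord_last xm0 Dz); congr (lin_coord x z2 _ z1).
Qed.

Lemma hcoord_lin_coord (R : realType) (n : nat) (D : set (R[i] * R[i]))
    (x : R[i] -> R[i] -> 'rV[R[i]]_n.+1) (z1 z2 : R[i]) (i : nat) :
  xm_neq0_on D x -> D (z1, z2) ->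
  hcoord (x z1 z2) i = lin_coord x z2 i z1 / lin_coord x z2 0 z1.
Proof.
move=> xm0 Dz; have := xm0 _ _ Dz; rewrite -hcoord_last => h0.
by rewrite /lin_coord [X in _ / (X / _)]/hcoord /= div1r invrK divfK.
Qed.

(** The nonlinear term - h_1 h_i is proportional to h_i with a factor independent
   of i, so it cancels in the derivative of h_i / h_m. *)
Lemma z1_flow_chain (R : realType) (n : nat) (D : set (R[i] * R[i]))
    (x : R[i] -> R[i] -> 'rV[R[i]]_n.+1) (z2 : R[i]) :
  xm_neq0_on D x -> z1_flow_on D x ->
  derivative_chain [set z1 | D (z1, z2)] (lin_coord x z2).
Proof.
move=> xm0 xflow i z1 /= Dz.
have h0 : hcoord (x z1 z2) n.+1 != 0 by rewrite hcoord_last xm0.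
apply: is_derive_eq.
  apply: is_derive_div; [exact: h0 | exact: z1_flow_hcoord xflow _ _ Dz _..].
rewrite /lin_coord [hcoord _ n.+2]hcoord_gt//; field.
exact: h0.
Qed.

(** The converse of the linearization: the derivative of the denominator Y_0 is
   Y_1, which creates the quadratic term of the Riccati equations. *)
Lemma chain_ratio (K : numFieldType) (A : set K) (Y : nat -> K -> K) (z : K)
    (i : nat) :
  derivative_chain A Y -> A z -> Y 0%N z != 0 ->
  is_derive z 1 (fun w => Y i w / Y 0%N w)
    (Y i.+1 z / Y 0%N z - Y 1%N z / Y 0%N z * (Y i z / Y 0%N z)).
Proof.
move=> dY Az Y0; rewrite [X in _ - X]mulrC.
by apply: is_derive_div => //; exact: dY.
Qed.

Lemma chain_z1_flow (R : realType) (n : nat) (D : set (R[i] * R[i]))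
    (x : R[i] -> R[i] -> 'rV[R[i]]_n.+1) :
  open_slices D -> xm_neq0_on D x ->
  (forall z2, derivative_chain [set z1 | D (z1, z2)] (lin_coord x z2)) ->
  z1_flow_on D x.
Proof.
move=> Dopen xm0 dY z1 z2 Dz j.
rewrite riccati_field_hcoord !(hcoord_lin_coord _ xm0 Dz).
apply: (@near_eq_is_derive _ _ _
  (fun w => lin_coord x z2 j.+1 w / lin_coord x z2 0 w)).
  have : \forall w \near z1, D (w, z2).
    by exact: open_nbhs_nbhs (conj (Dopen z2) Dz).
  by apply: filterS => w Dw; rewrite -(hcoord_lin_coord _ xm0 Dw) hcoordS.
apply: (chain_ratio (A := [set z1 | D (z1, z2)])) => //.
by rewrite /lin_coord mul1r invr_neq0// hcoord_last xm0.
Qed.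

(** The equations of the chain are those of the triangular system for i < m; the
   other ones hold because Y_m = 1 on D and Y_i = 0 for i > m. *)
Lemma triangular_chain (R : realType) (n : nat) (D : set (R[i] * R[i]))
    (x : R[i] -> R[i] -> 'rV[R[i]]_n.+1) :
  open_slices D -> xm_neq0_on D x ->
  triangular_on n.+1 D (ycoord x) (ucoord x) <->
  (forall z2, derivative_chain [set z1 | D (z1, z2)] (lin_coord x z2)).
Proof.
move=> Dopen xm0; split=> [tri z2 i z1 /= Dz|dY z1 z2 Dz].
  have [dy dylast du] := tri _ _ Dz.
  case: i => [|i]; first by rewrite -(lin_coord1 xm0 Dz) -ucoord_fun.
  have [ltin|] := ltnP i n.
    rewrite -(ycoord_fun x z2 (i := i.+1)) ?ltnS ?(ltnW ltin)//.
    have [eqin|neqin] := eqVneq i.+1 n.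
      rewrite eqin (lin_coord_last xm0 Dz); apply: dylast.
      by rewrite -eqin.
    rewrite -ycoordE ?ltnS//; apply: dy => //.
    by rewrite !ltnS ltn_neqAle neqin ltin.
  rewrite leq_eqVlt => /predU1P[<-|ltni].
    (* Y_m is 1 only where x_m != 0, hence the neighbourhood contained in D. *)
    rewrite lin_coord_gt//; apply: (@near_eq_is_derive _ _ _ (fun=> 1 : R[i])).
      have : \forall w \near z1, D (w, z2).
        by exact: open_nbhs_nbhs (conj (Dopen z2) Dz).
      by apply: filterS => w Dw; rewrite (lin_coord_last xm0 Dw).
  rewrite lin_coord_gt ?ltnS 1?ltnW//.
  rewrite (_ : lin_coord _ _ _ = cst 0); first exact: is_derive_cst.
  by apply/funext => w; rewrite lin_coord_gt.
have dYz i := dY z2 i z1 Dz.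
split=> [i i0 iltn|n1|].
- have iin : (0 < i <= n.+1)%N by rewrite i0 (ltnW (ltnW iltn)).
  by rewrite ycoord_fun// ycoordE ?(ltnW iltn)//; exact: dYz.
- have := dYz n; rewrite (lin_coord_last xm0 Dz) -ycoord_fun//.
  by rewrite leqnSn andbT -ltnS.
- by rewrite (lin_coord1 xm0 Dz) ucoord_fun; exact: dYz.
Qed.

(** * Polynomial solutions *)

(** The Taylor coefficients of u: the free constants, then 1 in degree m. *)
Definition ucoef (K : numFieldType) (n : nat) (b : 'I_n.+1 -> K) (k : nat) : K :=
  if (k < n.+1)%N then b (inord k) else (k == n.+1)%:R.

Lemma ucoef_gt (K : numFieldType) (n : nat) (b : 'I_n.+1 -> K) (k : nat) :
  (n.+2 <= k)%N -> ucoef b k = 0.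
Proof. by move=> nk; rewrite /ucoef ltnNge (ltnW nk) gtn_eqF. Qed.

Lemma upoly_taylor (R : realType) (n : nat) (a : 'I_n.+1 -> R[i] -> R[i])
    (z1 z2 : R[i]) :
  upoly a z1 z2 = (taylor_poly n.+2 (ucoef (a^~ z2)) 0).[z1].
Proof.
rewrite /upoly horner_poly [RHS]big_ord_recr /= [RHS]addrC.
congr (_ + _); first by rewrite /ucoef ltnn eqxx mul1r mulrC.
apply: eq_bigr => k _; rewrite add0n /ucoef ltn_ord inord_val.
by rewrite -mulrA [_^-1 * _]mulrC.
Qed.

Lemma taylor_poly_last (K : numFieldType) (n : nat) (b : 'I_n.+1 -> K) (z : K) :
  (taylor_poly n.+2 (ucoef b) n.+1).[z] = 1.
Proof.
by rewrite taylor_poly_top ?/ucoef ?ltnn ?eqxx// => i; exact: ucoef_gt.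
Qed.

Lemma dz1_upoly (R : realType) (n : nat) (a : 'I_n.+1 -> R[i] -> R[i])
    (i : nat) (z1 z2 : R[i]) :
  dz1 i (upoly a) z1 z2 = (taylor_poly n.+2 (ucoef (a^~ z2)) i).[z1].
Proof.
rewrite /dz1; under eq_fun do rewrite upoly_taylor.
have := @taylor_poly_chain _ n.+2 (ucoef (a^~ z2)) setT (@ucoef_gt _ _ _).
by move/(derivative_chain_derive1n openT) => ->.
Qed.

Lemma general_solution_taylor (R : realType) (n : nat)
    (a : 'I_n.+1 -> R[i] -> R[i]) (z1 z2 : R[i]) (j : 'I_n.+1) :
  general_solution a z1 z2 0 j =
  (taylor_poly n.+2 (ucoef (a^~ z2)) j.+1).[z1] /
  (taylor_poly n.+2 (ucoef (a^~ z2)) 0).[z1].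
Proof.
rewrite mxE dz1_upoly upoly_taylor.
case: ifPn => //; rewrite -leqNgt => nj.
suff -> : j.+1 = n.+1 by rewrite taylor_poly_last.
by apply/eqP; rewrite eqn_leq ltn_ord.
Qed.

(** With the convention 1/0 = 0 the entries are the quotients Y_(j+1) / Y_0 of a
   chain at every point, so they can be differentiated at a point where u != 0
   without first restricting to a neighbourhood. *)
Lemma general_solution_flow (R : realType) (n : nat)
    (a : 'I_n.+1 -> R[i] -> R[i]) :
  z1_flow_on [set z | upoly a z.1 z.2 != 0] (general_solution a).
Proof.
move=> z1 z2 /= u0 j.
pose Y k z := (taylor_poly n.+2 (ucoef (a^~ z2)) k).[z].
have Y0 : Y 0%N z1 != 0 by rewrite /Y -upoly_taylor.
have hY i : hcoord (general_solution a z1 z2) i = Y i z1 / Y 0%N z1.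
  case: i => [|i]; first by rewrite divff.
  have [lti|gti] := ltnP i n.+1.
    by rewrite (hcoordS _ (Ordinal lti)) general_solution_taylor.
  rewrite hcoord_gt// /Y horner_poly big1 ?mul0r// => k _.
  by rewrite ucoef_gt ?mul0r// ltn_addr.
rewrite riccati_field_hcoord !hY.
under eq_fun do rewrite general_solution_taylor.
apply: (chain_ratio (A := setT)) => //.
by apply: taylor_poly_chain; exact: ucoef_gt.
Qed.

(** The coefficient of degree m is the value of Y_m, which is 1 on D; it is not
   among the free constants b. *)
Lemma lin_coord_taylor (R : realType) (n : nat) (D : set (R[i] * R[i]))
    (x : R[i] -> R[i] -> 'rV[R[i]]_n.+1) (z2 : R[i]) :
  open_slices D -> connected_slices D -> xm_neq0_on D x -> z1_flow_on D x ->
  exists b : 'I_n.+1 -> R[i], forall i z1, D (z1, z2) ->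
    lin_coord x z2 i z1 = (taylor_poly n.+2 (ucoef b) i).[z1].
Proof.
move=> Dopen Dconn xm0 xflow.
have [|c c0 cE] := nilpotent_chain_taylor (N := n.+2) (Dopen z2) (Dconn z2)
  (z1_flow_chain xm0 xflow).
  by move=> k z nk _; exact: lin_coord_gt.
exists (fun j => c j) => i z1 Dz; rewrite (cE _ _ Dz).
suff -> : ucoef (fun j : 'I_n.+1 => c j) = c by [].
apply/funext => k; rewrite /ucoef.
have [ltk|gtk] := ltnP k n.+1; first by rewrite inordK.
have [->|nk] := eqVneq k n.+1; last by rewrite c0// ltn_neqAle eq_sym nk.
have := cE n.+1 z1 Dz; rewrite (lin_coord_last xm0 Dz) taylor_poly_top.
  by move=> <-.
exact: c0.
Qed.

Theorem corollary4p3 (R : realType) (n : nat) :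
  [/\ (* the change of variables turns the z1-flow into the triangular system *)
      forall (D : set (R[i] * R[i])) (x : R[i] -> R[i] -> 'rV[R[i]]_n.+1),
        open_slices D -> xm_neq0_on D x ->
        (z1_flow_on D x <-> triangular_on n.+1 D (ycoord x) (ucoord x)),
      (* every solution with x_m != 0 is given by the formulas *)
      forall (D : set (R[i] * R[i])) (x : R[i] -> R[i] -> 'rV[R[i]]_n.+1),
        open_slices D -> connected_slices D -> xm_neq0_on D x ->
        z1_flow_on D x ->
        exists a : 'I_n.+1 -> R[i] -> R[i],
          forall z1 z2 : R[i], D (z1, z2) ->
            [/\ ucoord x z1 z2 = upoly a z1 z2,
                forall i : nat, (1 <= i)%N -> (i <= n)%N ->
                  ycoord x i z1 z2 = dz1 i (ucoord x) z1 z2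
              & x z1 z2 = general_solution a z1 z2]
    & (* conversely, the formulas give a solution for all a_0, ..., a_{m-1} *)
      forall a : 'I_n.+1 -> R[i] -> R[i],
        z1_flow_on [set z | upoly a z.1 z.2 != 0] (general_solution a)].
Proof.
split=> [D x Dopen xm0|D x Dopen Dconn xm0 xflow|a].
- split=> [xflow|tri].
    by apply/triangular_chain => // z2; exact: z1_flow_chain.
  by apply: chain_z1_flow => //; exact/triangular_chain.
- have /choice[b bE] := fun z2 => lin_coord_taylor z2 Dopen Dconn xm0 xflow.
  exists (fun k z2 => b z2 k) => z1 z2 Dz.
  have bEz i := bE z2 i z1 Dz.
  split=> [|i i0 lein|].
  + by rewrite ucoordE upoly_taylor; exact: bEz.
  + rewrite /dz1 ucoord_fun (derivative_chain_derive1n (Dopen z2))//.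
      by rewrite -ycoordE// i0 leqW.
    exact: z1_flow_chain.
  + apply/rowP => j; rewrite general_solution_taylor -hcoordS.
    by rewrite (hcoord_lin_coord _ xm0 Dz) !bEz.
- exact: general_solution_flow.
Qed.
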